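(* Let $\omega$ be a factor of $D_\infty$ with $\mathrm{Env}(\omega)=E_{m,i}$, $i=1,2$. Then $\omega$ has a unique envelope extension $$E_{m,i}=\mu_1(\omega)\,\omega\,\mu_2(\omega),$$ where $\mu_1(\omega)$ and $\mu_2(\omega)$ are constant words depending only on $\omega$.
   Context: Let $\sigma$ be the substitution on the alphabet $\{a,b\}$ with $\sigma(a)=ab$, $\sigma(b)=aa$. The Doubling sequence is $D_\infty=\sigma^\infty(a)=abaaabab\cdots$, the infinite fixed point of $\sigma$ beginning with $a$. Put $A_m=\sigma^m(a)$ for $m\ge0$ and let $\delta_m$ be the last letter of $A_m$. For $m\ge1$ the envelope words are $E_{m,1}=A_m\delta_m^{-1}$ (i.e. $A_m$ with its last letter removed) and $E_{m,2}=A_{m-1}A_m\delta_m^{-1}$ (i.e. $A_{m-1}A_m$ with its last letter removed). They are ordered as follows: $E_{m_1,i_1}\sqsubset E_{m_2,i_2}$ if $m_1<m_2$, or if $m_1=m_2$ and $i_1<i_2$. For a factor $\omega$ of $D_\infty$, $\mathrm{Env}(\omega)$ is the minimal envelope word (under $\sqsubset$) having $\omega$ as a factor. Uniqueness of the envelope extension means that $\omega$ occurs only once in $E_{m,i}$, i.e. there is only one pair of words $(\mu_1,\mu_2)$ with $E_{m,i}=\mu_1\omega\mu_2$. *)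

(* Defs.v *)
From HB Require Import structures.
From mathcomp Require Import all_boot.
From mathcomp Require Import zify.
Set Implicit Arguments.
Unset Strict Implicit.
Unset Printing Implicit Defensive.

Inductive letter := La | Lb.

Definition bool_of_letter (x : letter) : bool := if x is La then true else false.
Definition letter_of_bool (t : bool) : letter := if t then La else Lb.
Lemma bool_of_letterK : cancel bool_of_letter letter_of_bool.
Proof. by case. Qed.
HB.instance Definition _ := Equality.copy letter (can_type bool_of_letterK).

Definition word := seq letter.

Definition sigma (x : letter) : word :=
  if x is La then [:: La; Lb] else [:: La; La].

Definition subst (w : word) : word := flatten (map sigma w).

Definition A (m : nat) : word := iter m subst [:: La].

(* The n-th letter (from 0) of the infinite fixed point: A n is a prefix of it,
   of length 2 ^ n > n.  See mkseq_D and D_fixed below. *)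
Definition D (n : nat) : letter := nth La (A n) n.

(* Factors of the infinite word are its finite blocks of consecutive letters;
   factors of finite words are given by [infix]. *)
Definition factorD (w : word) : Prop :=
  exists k : nat, w = mkseq (fun j => D (k + j)) (size w).

Definition delta (m : nat) : letter := last La (A m).

Definition drop_last (w : word) : word := take (size w).-1 w.

(* E m i is E_{m,i}; only meaningful when [env_index m i] holds. *)
Definition E (m i : nat) : word :=
  if i == 1 then drop_last (A m) else drop_last (A m.-1 ++ A m).

Definition env_index (m i : nat) : Prop := 1 <= m /\ (i = 1 \/ i = 2).

Definition env_lt (m1 i1 m2 i2 : nat) : Prop :=
  m1 < m2 \/ (m1 = m2 /\ i1 < i2).

(* Env(w) = E_{m,i} *)
Definition is_Env (w : word) (m i : nat) : Prop :=
  [/\ env_index m i, infix w (E m i)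
    & forall m' i', env_index m' i' -> infix w (E m' i') ->
        ~ env_lt m' i' m i].

Lemma subst_cat u v : subst (u ++ v) = subst u ++ subst v.
Proof. by rewrite /subst map_cat flatten_cat. Qed.

Lemma size_subst w : size (subst w) = (size w).*2.
Proof.
elim: w => [|x w IH] //.
by rewrite -cat1s subst_cat !size_cat IH doubleD; case: x.
Qed.

Lemma size_A m : size (A m) = 2 ^ m.
Proof.
elim: m => [|m IH] //.
by rewrite -[A m.+1]/(subst (A m)) size_subst IH expnS mul2n.
Qed.

Lemma A_prefixS m : exists v, A m.+1 = A m ++ v.
Proof.
elim: m => [|m [v IH]]; first by exists [:: Lb].
by exists (subst v); rewrite -[LHS]/(subst (A m.+1)) {1}IH subst_cat.
Qed.

Lemma A_prefix m n : m <= n -> exists v, A n = A m ++ v.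
Proof.
elim: n => [|n IH]; first by rewrite leqn0 => /eqP->; exists [::]; rewrite cats0.
rewrite leq_eqVlt => /orP[/eqP->|/IH[v Ev]]; first by exists [::]; rewrite cats0.
by have [u ->] := A_prefixS n; exists (v ++ u); rewrite Ev catA.
Qed.

Lemma nth_A m n : n < 2 ^ m -> nth La (A m) n = D n.
Proof.
move=> lt_n; have lt_nn : n < 2 ^ n by apply: ltn_expl.
rewrite /D; case: (leqP m n) => [|/ltnW] /A_prefix[v ->].
  by rewrite nth_cat size_A lt_n.
by rewrite nth_cat size_A lt_nn.
Qed.

Lemma mkseq_D m : mkseq D (2 ^ m) = A m.
Proof.
apply: (@eq_from_nth _ La); rewrite size_mkseq ?size_A // => i lt_i.
by rewrite nth_mkseq // nth_A.
Qed.

Lemma D_fixed n : subst (mkseq D n) = mkseq D n.*2.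
Proof.
have lt_n : n < 2 ^ n by apply: ltn_expl.
have take_D k m : k <= 2 ^ m -> mkseq D k = take k (A m).
  move=> le_k; rewrite -mkseq_D /mkseq -map_take take_iota.
  by rewrite (minn_idPl le_k).
rewrite (take_D n n) ?(ltnW lt_n) // (take_D n.*2 n.+1); last first.
  by rewrite expnS mul2n leq_double ltnW.
have -> : A n.+1 = subst (take n (A n)) ++ subst (drop n (A n)).
  by rewrite -subst_cat cat_take_drop.
by rewrite take_size_cat // size_subst size_takel // size_A ltnW.
Qed.

Lemma A_delta m : A m = rcons (drop_last (A m)) (delta m).
Proof.
have : 0 < size (A m) by rewrite size_A expn_gt0.
rewrite /drop_last /delta; elim/last_ind: (A m) => [|s x _] // _.
by rewrite size_rcons last_rcons -{2}cats1 take_size_cat.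
Qed.

Lemma E1_delta m : A m = rcons (E m 1) (delta m).
Proof. exact: A_delta. Qed.

Lemma E2_delta m : A m.-1 ++ A m = rcons (E m 2) (delta m).
Proof.
have drop_last_rcons (s : word) x : drop_last (rcons s x) = s.
  by rewrite /drop_last size_rcons -cats1 take_size_cat.
by rewrite /E /= [in RHS](A_delta m) -rcons_cat drop_last_rcons rcons_cat -A_delta.
Qed.

Lemma factorD_E1 w : factorD w -> exists2 m, 1 <= m & infix w (E m 1).
Proof.
case=> k Ew; set N := k + size w + 1; exists N; first by rewrite /N addn1.
have lt_N : N < 2 ^ N by apply: ltn_expl.
have sE : size (E N 1) = (2 ^ N).-1.
  by have := congr1 size (E1_delta N); rewrite size_A size_rcons => ->.
have -> : w = take (size w) (drop k (E N 1)).
  have sz : size (take (size w) (drop k (E N 1))) = size w.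
    by rewrite size_takel // size_drop sE; lia.
  apply: (@eq_from_nth _ La); first by rewrite sz.
  move=> i lt_i; rewrite nth_take // nth_drop {1}Ew nth_mkseq //.
  have <- : nth La (A N) (k + i) = D (k + i) by apply: nth_A; lia.
  by rewrite (E1_delta N) nth_rcons sE; case: ltnP => //; lia.
apply/infixP; exists (take k (E N 1)), (drop (size w) (drop k (E N 1))).
by rewrite !cat_take_drop.
Qed.

Lemma is_Env_exists w : factorD w -> exists m i, is_Env w m i.
Proof.
case/factorD_E1=> m0 m0_gt0 w_m0.
pose P m := (0 < m) && (infix w (E m 1) || infix w (E m 2)).
have exP : exists m, P m by exists m0; rewrite /P m0_gt0 w_m0.
case: (ex_minnP exP) => m /andP[m_gt0 w_m] min_m.
have Pidx m' i' : env_index m' i' -> infix w (E m' i') -> m <= m'.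
  by case=> m'_gt0 [] -> w_m'; apply: min_m; rewrite /P m'_gt0 w_m' ?orbT.
case: (boolP (infix w (E m 1))) => [w1|w1]; [exists m, 1|exists m, 2]; split=> //.
- by split=> //; left.
- move=> m' i' idx /(Pidx _ _ idx) le_m [|[_]]; first lia.
  by case: idx => _ []->.
- by split=> //; right.
- by rewrite (negbTE w1) in w_m.
- move=> m' i' idx w_m' [|[Em lt_i]]; first by have := Pidx _ _ idx w_m'; lia.
  have Ei : i' = 1 by case: idx => _ [] E0; lia.
  by rewrite Em Ei (negbTE w1) in w_m'.
Qed.

Lemma is_Env_uniq w m i m' i' :
  is_Env w m i -> is_Env w m' i' -> m = m' /\ i = i'.
Proof.
case=> idx w_mi min [idx' w_mi' min'].
have := min _ _ idx' w_mi'; have := min' _ _ idx w_mi.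
by rewrite /env_lt; lia.
Qed.

(* Main.v *)
Require Import Defs.
From mathcomp Require Import all_boot.
From mathcomp Require Import zify.
From Stdlib Require Import ClassicalEpsilon.

(** If a nonempty word [w] occurs twice in [E m i], it already occurs in a smaller
    envelope word; this contradicts minimality of [Env].  The induction on [m]
    rests on [E m.+1 i = subst (E m i) ++ [:: La]]: there the letters at even
    positions are all [La], so when [w] contains [Lb] its two occurrences have the
    same parity and desubstitute to two occurrences in [E m i] of a shorter word.
    When [w] is a power of [La], its exponent is at most 3, and it occurs in
    [E 1 1], [E 1 2] or [E 3 1]. *)

(** The second letter of [sigma x]; the first one is always [La]. *)
Definition flip (x : letter) : letter := if x is La then Lb else La.

(** The closing [La] is what remains of the last [sigma] block when an image word loses its last
    letter. *)
Definition subst_a (u : word) : word := subst u ++ [:: La].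

(** The size bound keeps the default [La] of [nth] from faking a match beyond the end of [u]. *)
Definition occ (w u : word) (p : nat) : Prop :=
  p + size w <= size u /\
  forall j, j < size w -> nth La u (p + j) = nth La w j.

Lemma size_subst_a u : size (subst_a u) = (size u).*2.+1.
Proof. by rewrite size_cat size_subst addn1. Qed.

Lemma nth_subst_a u k : k < size (subst_a u) ->
  nth La (subst_a u) k = if odd k then flip (nth La u k./2) else La.
Proof.
rewrite size_subst_a; elim: u k => [|x u IH] [|[|k]] // lt_k.
- by case: x lt_k.
- by case: x lt_k.
have -> : nth La (subst_a (x :: u)) k.+2 = nth La (subst_a u) k by case: x lt_k.
by rewrite IH //= negbK.
Qed.

Lemma drop_last_rcons u x : drop_last (rcons u x) = u.
Proof. by rewrite /drop_last size_rcons -cats1 take_size_cat. Qed.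

Lemma drop_last_subst u : u <> [::] ->
  drop_last (subst u) = subst_a (drop_last u).
Proof.
case/lastP: u => // u x _; rewrite drop_last_rcons -cats1 subst_cat.
have -> : subst [:: x] = [:: La; flip x] by case: x.
by rewrite -(drop_last_rcons (subst_a u) (flip x)) -cats1 -catA.
Qed.

(** Level 0 is excluded because [m.-1] truncates there: [E 0 2] is [a], with image [aba], whereas
    [E 1 2] is [aa]. *)
Lemma ES m i : 0 < m -> E m.+1 i = subst_a (E m i).
Proof.
have A_neq0 n : A n <> [::] by move/(congr1 size); rewrite size_A /=; lia.
case: m => // m _; rewrite /E; case: ifP => _; rewrite -drop_last_subst //.
  by rewrite subst_cat.
by case: (A m) (A_neq0 m).
Qed.

Lemma occ_cat s w t : occ w (s ++ w ++ t) (size s).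
Proof.
split=> [|j lt_j]; first by rewrite !size_cat; lia.
by rewrite nth_cat ltnNge leq_addr addKn nth_cat lt_j.
Qed.

Lemma infix_occ (w u : word) : infix w u <-> exists p, occ w u p.
Proof.
split=> [/infixP[s [t ->]]|[p [le_p eq_w]]].
  by exists (size s); apply: occ_cat.
apply/infixP; exists (take p u), (drop (size w) (drop p u)).
have -> : w ++ drop (size w) (drop p u) = drop p u; last by rewrite cat_take_drop.
rewrite -[RHS](cat_take_drop (size w)); congr (_ ++ _).
have sz : size (take (size w) (drop p u)) = size w.
  by rewrite size_takel // size_drop; lia.
apply: (@eq_from_nth _ La) => // j lt_j.
by rewrite nth_take // nth_drop eq_w.
Qed.

(** Every [sigma] block starts with [La], so the closing [La] of [subst_a w] matches the start of
    the next block or the closing [La] of [subst_a u]. *)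
Lemma infix_subst_a (w u : word) : infix w u -> infix (subst_a w) (subst_a u).
Proof.
case/infixP=> s [t ->]; apply/infixP; rewrite /subst_a !subst_cat.
exists (subst s); case: t => [|x t]; first by exists [::]; rewrite !cats0 catA.
have [y Ey] : exists y, subst (x :: t) = La :: y.
  by case: x; eexists.
by exists (y ++ [:: La]); rewrite Ey -!catA.
Qed.

(** In [subst_a u] the letter [Lb] sits only at odd positions, which forces [p] and [q] to have the
    same parity. *)
Lemma desubst (w u : word) p q : occ w (subst_a u) p -> occ w (subst_a u) q ->
    Lb \in w -> p < q ->
  exists w' p' q',
    [/\ w' <> [::], infix w (subst_a w'), p' < q', occ w' u p' & occ w' u q'].
Proof.
move=> [le_p eq_p] [le_q eq_q] b_w lt_pq; rewrite size_subst_a in le_p le_q.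
have nth_occ r j : r + size w <= (size u).*2.+1 ->
    (forall j, j < size w -> nth La (subst_a u) (r + j) = nth La w j) ->
    j < size w ->
    nth La w j = if odd (r + j) then flip (nth La u (r + j)./2) else La.
  by move=> le_r eq_r lt_j; rewrite -eq_r // nth_subst_a // size_subst_a; lia.
have {eq_p}np j := nth_occ p j le_p eq_p.
have {eq_q nth_occ}nq j := nth_occ q j le_q eq_q.
pose jb := index Lb w.
have lt_jb : jb < size w by rewrite index_mem.
have odd_p : odd (p + jb).
  by have := np jb lt_jb; rewrite nth_index //; case: ifP.
have odd_q : odd (q + jb).
  by have := nq jb lt_jb; rewrite nth_index //; case: ifP.
have par : odd p = odd q by move: odd_p odd_q; rewrite !oddD; do 3 case: odd.
(* The number of odd positions from [p] to [p + size w - 1], each the second letter of one block. *)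
pose n := (p + size w)./2 - p./2.
pose w' := mkseq (fun k => nth La u (p./2 + k)) n.
have szw' : size w' = n by rewrite size_mkseq.
exists w', p./2, q./2; split.
- by move/(congr1 size); rewrite szw' /n /=; lia.
(* For odd [p], [w] starts at the second letter of a block, hence this offset. *)
- apply/infix_occ; exists (odd p : nat); split=> [|j lt_j].
    by rewrite size_subst_a szw' /n; lia.
  rewrite nth_subst_a ?size_subst_a ?szw' /n; last lia.
  rewrite np // !oddD oddb; case: ifP => // odd_j.
  rewrite nth_mkseq; last by rewrite /n; lia.
  by congr (flip (nth _ _ _)); lia.
- lia.
- split=> [|k]; rewrite szw'; first (by rewrite /n; lia); move=> lt_k.
  by rewrite nth_mkseq.
split=> [|k]; rewrite szw'; first (by rewrite /n; lia); move=> lt_k.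
rewrite nth_mkseq //.
(* The index in [w] of the second letter of block [k]; it determines the letter of [u], as [flip] is
   injective. *)
pose j := k.*2.+1 - odd p.
have lt_j : j < size w by rewrite /j; move: lt_k; rewrite /n; lia.
have := np j lt_j; rewrite nq // !ifT; try by rewrite /j; lia.
have -> : (q + j)./2 = q./2 + k by rewrite /j; lia.
have -> : (p + j)./2 = p./2 + k by rewrite /j; lia.
by do 2 case: nth.
Qed.

Lemma Lb_free_nseq (w : word) : Lb \notin w -> w = nseq (size w) La.
Proof.
elim: w => //= x w IH; rewrite inE negb_or => /andP[nx /IH {1}->].
by case: x nx.
Qed.

Lemma E1 i : env_index 1 i -> E 1 i = nseq i La.
Proof. by case=> _ [] ->. Qed.

(** Four consecutive positions contain two successive odd ones. An [La] at both would come from [Lb]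
    at two adjacent positions one level down, and [bb] never occurs there. *)
Lemma no_aaaa m i p : env_index m i -> ~ occ (nseq 4 La) (E m i) p.
Proof.
case=> m_gt0 idx [le_p eq_p].
have {eq_p} a_at j : j < 4 -> nth La (E m i) (p + j) = La.
  by move=> lt_j; rewrite eq_p // nth_nseq if_same.
case: m m_gt0 le_p a_at => // [[|m]] _; first by case: idx => -> /=; lia.
rewrite ES // size_subst_a => le_p a_at.
have b_at k : p <= k.*2.+1 < p + 4 -> nth La (E m.+1 i) k = Lb.
  move=> lt_k; have := a_at (k.*2.+1 - p); rewrite subnKC; last lia.
  rewrite nth_subst_a ?size_subst_a /= ?odd_double /=; last by move: le_p; rewrite size_nseq; lia.
  rewrite uphalf_double; case: nth => // H; by have := H ltac:(lia).
have b1 := b_at p./2 ltac:(lia).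
have b2 := b_at p./2.+1 ltac:(lia).
move: le_p b1 b2; rewrite size_nseq; case: m {a_at b_at} => [|m] le_p.
  by rewrite E1 //; rewrite nth_nseq; case: ifP.
rewrite ES // in le_p *; rewrite size_subst_a in le_p.
by rewrite !nth_subst_a ?size_subst_a; try lia; move=> /=; case: odd.
Qed.

(** Nonemptiness matters: the empty word occurs twice already in [E 1 1], the least envelope
    word. *)
Lemma repeated_in_smaller_E m i (w : word) p q :
    env_index m i -> w <> [::] -> p < q ->
    occ w (E m i) p -> occ w (E m i) q ->
  exists m' i', [/\ env_index m' i', infix w (E m' i') & env_lt m' i' m i].
Proof.
elim: m w p q => [|m IH] w p q; first by case.
move=> [_ idx] w_n0 lt_pq occ_p occ_q.
have [b_w|] := boolP (Lb \in w).
  have [m0|m_gt0] := posnP m.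
    have [_ /(_ (index Lb w))] := occ_p.
    rewrite index_mem m0 nth_index // E1 // nth_nseq if_same.
    by move=> /(_ b_w).
  rewrite ES // in occ_p occ_q.
  have [w' [p' [q' [w'_n0 w_w' lt' occ_p' occ_q']]]] :=
    desubst _ _ _ _ occ_p occ_q b_w lt_pq.
  have [||m' [i' [idx' w'_E lt_E]]] := IH w' p' q' _ _ lt' occ_p' occ_q' => //.
  exists m'.+1, i'; split.
  - by case: idx'.
  - rewrite ES; last by case: idx'.
    exact: infix_trans w_w' (infix_subst_a _ _ w'_E).
  by move: lt_E; rewrite /env_lt; lia.
move/Lb_free_nseq => Ew.
have le3 : size w <= 3.
  rewrite leqNgt; apply/negP=> gt3.
  apply: (no_aaaa m.+1 i p) => //; split; first by case: occ_p => /=; lia.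
  move=> j lt_j; case: occ_p => _ ->; last by move: lt_j => /=; lia.
  by rewrite Ew !nth_nseq !if_same.
have a_at r j : occ w (E m.+1 i) r -> j < size w -> nth La (E m.+1 i) (r + j) = La.
  by case=> _ H /H ->; rewrite Ew nth_nseq if_same.
have ap j := a_at p j occ_p; have aq j := a_at q j occ_q.
case: occ_p occ_q => [le_p _] [le_q _].
have : 0 < size w by case: (w) w_n0.
case: (size w) le3 Ew le_p le_q ap aq => [|[|[|[|n]]]] // _ -> le_p le_q ap aq _.
- exists 1, 1; split=> //; first by split; [|left].
  case: m le_p le_q {IH a_at ap aq} => [|m] le_p le_q; last by left.
  by move: le_q; rewrite E1 // size_nseq /env_lt; lia.
- exists 1, 2; split=> //; first by split; [|right].
  case: m le_p le_q {IH a_at ap aq} => [|m] le_p le_q; last by left.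
  by move: le_q; rewrite E1 // size_nseq /env_lt; lia.
(* For [aaa]: level 1 is too short, level 2 alternates [a] and [b], and [E 3 1] contains [aaa] only
   once. *)
exists 3, 1; split=> //; first by split; [|left].
rewrite /env_lt; case: m le_p le_q ap aq {IH a_at} => [|[|[|m]]] le_p le_q ap aq.
- by move: le_q; rewrite E1 // size_nseq; lia.
- have := ap 0 isT; have := ap 1 isT; rewrite ES // E1 //.
  move: le_p le_q; rewrite ES // E1 // size_subst_a size_nseq => le_p le_q.
  by rewrite !nth_subst_a ?size_subst_a ?size_nseq ?nth_nseq ?if_same /= ?addn0 ?addn1 /=;
     try lia; case: odd.
- case: idx => Ei; last by lia.
  have E31 : E 3 1 = [:: La; Lb; La; La; La; Lb; La] by [].
  rewrite Ei E31 /= in le_p le_q ap aq.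
  have := ap 0 isT; have := ap 1 isT; have := aq 0 isT; have := aq 1 isT.
  have := aq 2 isT; have : q <= 4 by lia.
  by case: p q lt_pq {le_p le_q ap aq} => [|[|[|[|p]]]] [|[|[|[|[|q]]]]].
by left.
Qed.

Lemma is_Env_occ_uniq w m i p q :
  w <> [::] -> is_Env w m i -> occ w (E m i) p -> occ w (E m i) q -> p = q.
Proof.
move=> w_n0 [idx _ min] occ_p occ_q.
have no_lt r s : occ w (E m i) r -> occ w (E m i) s -> ~~ (r < s).
  move=> occ_r occ_s; apply/negP=> lt_rs.
  have [m' [i' [idx' w_E]]] := repeated_in_smaller_E _ _ _ _ _ idx w_n0 lt_rs occ_r occ_s.
  exact: min.
by have := no_lt _ _ occ_p occ_q; have := no_lt _ _ occ_q occ_p; lia.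
Qed.

Theorem theorem3p7 :
  exists mu1 mu2 : word -> word,
    forall (w : word) (m i : nat),
      w <> [::] -> factorD w -> is_Env w m i ->
      E m i = mu1 w ++ w ++ mu2 w /\
      (forall nu1 nu2 : word,
         E m i = nu1 ++ w ++ nu2 -> nu1 = mu1 w /\ nu2 = mu2 w).
Proof.
(* Binding [m] and [i] inside [ext] lets [epsilon] choose a pair that depends on [w] alone;
   [is_Env_uniq] recovers the given indices. *)
pose ext w (nu : word * word) :=
  exists m i, is_Env w m i /\ E m i = nu.1 ++ w ++ nu.2.
pose mu w := epsilon (inhabits ([::], [::])) (ext w).
exists (fst \o mu), (snd \o mu) => w m i w_n0 _ env_w.
have : ext w (mu w).
  apply: epsilon_spec; have [_ /infixP[s [t Est]] _] := env_w.
  by exists (s, t), m, i.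
case=> m' [i' [env_w' Emu]]; have [Em Ei] := is_Env_uniq env_w env_w'.
rewrite -Em -Ei in Emu; split=> // nu1 nu2 Enu.
have occ_mu : occ w (E m i) (size (mu w).1) by rewrite Emu; apply: occ_cat.
have occ_nu : occ w (E m i) (size nu1) by rewrite Enu; apply: occ_cat.
(* Equal offsets give the two left parts equal length, so the factorizations cancel piece by
   piece. *)
have sz := is_Env_occ_uniq _ _ _ _ _ w_n0 env_w occ_nu occ_mu.
have /eqP : nu1 ++ w ++ nu2 = (mu w).1 ++ w ++ (mu w).2 by rewrite -Enu.
by rewrite eqseq_cat // eqseq_cat // eqxx => /andP[/eqP-> /eqP->].
Qed.
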